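(* Let $V$ be the set of integer points $(x,y,z)\in\mathbb{Z}^3$ such that none of $x+y,\ x-y,\ y+z,\ y-z,\ z+x,\ z-x$ is congruent to $0 \pmod 4$, let $G$ be the graph with vertex set $V$ in which two vertices are adjacent exactly when their Euclidean distance is $\sqrt{2}$, let $O=(0,1,2)$, and for $P\in V$ let $\operatorname{dis}(P)$ be the graph distance in $G$ from $O$ to $P$. For an integer $n\ge 0$ let $$S(n)=\#\{P\in V:\operatorname{dis}(P)=n\},\qquad \bar S(n)=\#\{P=(x,y,z)\in V:\operatorname{dis}(P)=n,\ xyz=0\}.$$ Then $\bar S(0)=1$ and $\bar S(n)=4n$ for $n>0$; and $S(0)=1$ and $S(n)=2(n^2+1)$ for $n>0$.
   Context: $G$ is the sodalite network: the edge-skeleton of the uniform tiling of Euclidean 3-space by truncated octahedra, scaled by a factor 4; each vertex has four neighbours. $S(n)$ is the coordination sequence of this network, and $\bar S(n)$ counts the vertices at height $n$ lying on the coordinate planes. *)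

(* Defs.v *)
From Stdlib Require Import ZArith List.
Open Scope Z_scope.

Definition point : Type := (Z * Z * Z)%type.

Definition inV (p : point) : Prop :=
  let '(x, y, z) := p in
  (x + y) mod 4 <> 0 /\ (x - y) mod 4 <> 0 /\
  (y + z) mod 4 <> 0 /\ (y - z) mod 4 <> 0 /\
  (z + x) mod 4 <> 0 /\ (z - x) mod 4 <> 0.

Definition dist2 (p q : point) : Z :=
  let '(x1, y1, z1) := p in
  let '(x2, y2, z2) := q in
  (x1 - x2) ^ 2 + (y1 - y2) ^ 2 + (z1 - z2) ^ 2.

Definition adj (p q : point) : Prop := inV p /\ inV q /\ dist2 p q = 2.

Definition O : point := (0, 1, 2).

Inductive walk : nat -> point -> Prop :=
| walk0 : inV O -> walk 0 O
| walkS : forall n p q, walk n p -> adj p q -> walk (S n) q.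

Definition dis_eq (P : point) (n : nat) : Prop :=
  walk n P /\ forall m, (m < n)%nat -> ~ walk m P.

Definition has_card (A : point -> Prop) (k : nat) : Prop :=
  exists l : list point, NoDup l /\ (forall P, In P l <-> A P) /\ length l = k.

Definition Sset (n : nat) (P : point) : Prop := inV P /\ dis_eq P n.

Definition Sbarset (n : nat) (P : point) : Prop :=
  inV P /\ dis_eq P n /\ (let '(x, y, z) := P in x * y * z = 0).

(* Main.v *)
Require Import Defs.
From Stdlib Require Import ZArith List.
From Stdlib Require Import Lia Arith FinFun.
Import ListNotations.

(** The vertices of [V] correspond to the alcoves cut out by the planes
    [l = 4 k], where [l] is one of the six forms [+-u + v] in two of the
    coordinates and [k] is an integer: this is the affine Weyl group of type A3,
    and an edge of the graph crosses exactly one plane. At [O] all six forms,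
    suitably signed, lie strictly between 0 and 4, so the distance from [O] to
    [P] is the number of planes separating them, i.e. the sum of [|floor (l / 4)|].

    To count, restrict first to the chamber [|x| < y < z]: it is tiled by the
    translates of a box with six vertices under (0,0,4), (-2,2,2) and (2,2,2),
    which add 4, 3 and 3 to the distance. Space is the disjoint union of 24
    images of the chamber under permutations and even sign changes, each of which
    adds a constant to the distance. The vertices on the coordinate planes
    correspond to the half-plane [x = 0] of the chamber, tiled in the same way by
    (0,0,4) and (0,4,4). *)

(** * Separating planes and edges *)

Definition fold_floor (l : Z) : Z := Z.abs (l / 4).

Definition separation (p : point) : Z :=
  let '(x, y, z) := p in
  fold_floor (x + y) + fold_floor (y - x) + fold_floor (y + z) +
  fold_floor (z - y) + fold_floor (z + x) + fold_floor (z - x).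

Lemma separation_nonneg p : 0 <= separation p.
Proof. destruct p as [[x y] z]; unfold separation, fold_floor; lia. Qed.

Lemma fold_floor_stay l l' :
  l mod 4 <> 0 -> l' mod 4 <> 0 -> -1 <= l' - l <= 1 ->
  fold_floor l' = fold_floor l.
Proof.
  intros H H' D; unfold fold_floor; f_equal; Z.div_mod_to_equations; lia.
Qed.

Lemma fold_floor_lipschitz l l' :
  -4 <= l' - l <= 4 -> fold_floor l' <= fold_floor l + 1.
Proof. intros D; unfold fold_floor; Z.div_mod_to_equations; lia. Qed.

(** The step crosses the multiple of 4 just below [l], which is at least 4 and so separates [l] from
    the interval (0,4). [fold_floor_up] is the mirror case, crossing a multiple that is at most
    0. *)
Lemma fold_floor_down l l' :
  l mod 4 = 1 -> 4 < l -> l' = l - 2 -> fold_floor l' = fold_floor l - 1.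
Proof. intros H P ->; unfold fold_floor; Z.div_mod_to_equations; lia. Qed.

Lemma fold_floor_up l l' :
  l mod 4 = 3 -> l < 0 -> l' = l + 2 -> fold_floor l' = fold_floor l - 1.
Proof. intros H P ->; unfold fold_floor; Z.div_mod_to_equations; lia. Qed.

(** Negation takes [l] across 0 and otherwise to the mirror interval. This one extra plane is the
    source of every constant in the folding by symmetries. *)
Lemma fold_floor_opp l l' :
  0 < l -> l mod 4 <> 0 -> l' = - l -> fold_floor l' = fold_floor l + 1.
Proof. intros H P ->; unfold fold_floor; Z.div_mod_to_equations; lia. Qed.

Lemma fold_floor_shift l l' :
  0 < l -> l' = l + 4 -> fold_floor l' = fold_floor l + 1.
Proof. intros H ->; unfold fold_floor; Z.div_mod_to_equations; lia. Qed.

Lemma fold_floor_shift2 l l' :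
  0 < l -> l' = l + 8 -> fold_floor l' = fold_floor l + 2.
Proof. intros H ->; unfold fold_floor; Z.div_mod_to_equations; lia. Qed.

Lemma mod4_opp l l' : l mod 4 <> 0 -> l' = - l -> l' mod 4 <> 0.
Proof. intros H ->; Z.div_mod_to_equations; lia. Qed.

Lemma mod4_shift l l' k : l mod 4 <> 0 -> l' = l + 4 * k -> l' mod 4 <> 0.
Proof. intros H ->; Z.div_mod_to_equations; lia. Qed.

Lemma three_squares_two a b c : a ^ 2 + b ^ 2 + c ^ 2 = 2 ->
  a = 0 /\ -1 <= b <= 1 /\ (c = b \/ c = - b) \/
  b = 0 /\ -1 <= a <= 1 /\ (c = a \/ c = - a) \/
  c = 0 /\ -1 <= a <= 1 /\ (b = a \/ b = - a).
Proof.
  assert (forall t, t = 0 \/ t = 1 \/ t = -1 \/ 4 <= t ^ 2) as Q by (intro t; nia).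
  assert (forall t, 0 <= t ^ 2) as P by (intro t; nia).
  intro H; pose proof (P a); pose proof (P b); pose proof (P c).
  destruct (Q a) as [-> | [-> | [-> |]]], (Q b) as [-> | [-> | [-> |]]],
    (Q c) as [-> | [-> | [-> |]]]; lia.
Qed.

(* Only the form u + v or u - v of the two moving coordinates changes by 2; the
   other forms change by at most 1 and, never being divisible by 4, keep their
   floor. *)
Lemma separation_adj p q : adj p q -> separation q <= separation p + 1.
Proof.
  destruct p as [[x y] z], q as [[x' y'] z'].
  unfold adj, inV, dist2.
  intros ((A1 & A2 & A3 & A4 & A5 & A6) & (B1 & B2 & B3 & B4 & B5 & B6) & D).
  apply mod4_opp with (l' := (y - x)) in A2; [| ring].
  apply mod4_opp with (l' := (z - y)) in A4; [| ring].
  apply mod4_opp with (l' := (y' - x')) in B2; [| ring].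
  apply mod4_opp with (l' := (z' - y')) in B4; [| ring].
  unfold separation.
  apply three_squares_two in D.
  destruct D as [(X & Y & [Z0 | Z0]) | [(X & Y & [Z0 | Z0]) | (X & Y & [Z0 | Z0])]];
  do 6 try match goal with
  | A : ?l mod 4 <> 0, B : ?l' mod 4 <> 0 |- context [fold_floor ?l'] =>
      rewrite (fold_floor_stay l l' A B) by (clear - X Y Z0; lia); clear A B
  end;
  first [lia | match goal with
  | A : ?l mod 4 <> 0, B : ?l' mod 4 <> 0 |- context [fold_floor ?l'] =>
      pose proof (fold_floor_lipschitz l l' ltac:(clear - X Y Z0; lia)) as F;
      clear - F; lia
  end].
Qed.

(** * Descent towards the origin vertex *)

Lemma inV_residues x y z : inV (x, y, z) ->
  (x mod 4 = 0 /\ y mod 4 = 2 \/ x mod 4 = 2 /\ y mod 4 = 0) /\ (z mod 4 = 1 \/ z mod 4 = 3) \/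
  (x mod 4 = 0 /\ z mod 4 = 2 \/ x mod 4 = 2 /\ z mod 4 = 0) /\ (y mod 4 = 1 \/ y mod 4 = 3) \/
  (y mod 4 = 0 /\ z mod 4 = 2 \/ y mod 4 = 2 /\ z mod 4 = 0) /\ (x mod 4 = 1 \/ x mod 4 = 3).
Proof.
  unfold inV.
  rewrite (Zplus_mod x y), (Zplus_mod y z), (Zplus_mod z x).
  rewrite (Zminus_mod x y), (Zminus_mod y z), (Zminus_mod z x).
  assert (forall t, t mod 4 = 0 \/ t mod 4 = 1 \/ t mod 4 = 2 \/ t mod 4 = 3) as R
    by (intro t; pose proof (Z.mod_pos_bound t 4); lia).
  destruct (R x) as [-> | [-> | [-> | ->]]], (R y) as [-> | [-> | [-> | ->]]],
    (R z) as [-> | [-> | [-> | ->]]]; cbv; intuition congruence.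
Qed.

Ltac Zify.zify_post_hook ::= Z.to_euclidean_division_equations.

Ltac compare_floor l l' :=
  let E := fresh "E" in
  first
    [ assert (E : fold_floor l' = fold_floor l) by (f_equal; ring)
    | let D := fresh in assert (D : l' = l - 2) by ring;
      assert (E : fold_floor l' = fold_floor l - 1)
        by (apply fold_floor_down; [lia | assumption | exact D]); clear D
    | let D := fresh in assert (D : l' = l + 2) by ring;
      assert (E : fold_floor l' = fold_floor l - 1)
        by (apply fold_floor_up; [lia | assumption | exact D]); clear D
    | assert (E : fold_floor l' = fold_floor l) by (apply fold_floor_stay; lia) ].

Ltac move_to x y z x' y' z' :=
  repeat match goal with H : ~ _ < _ |- _ => clear H end;
  right; exists (x', y', z');
  compare_floor (x + y) (x' + y'); compare_floor (y - x) (y' - x');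
  compare_floor (y + z) (y' + z'); compare_floor (z - y) (z' - y');
  compare_floor (z + x) (z' + x'); compare_floor (z - x) (z' - x');
  split; [ unfold adj, inV, dist2; repeat split; lia | unfold separation; lia ].

(** The vector (dx,dy,dz) is the gradient of [l]. A move along it changes [l] by 2 and is the
    reflection in the nearest plane, made only when that plane separates the vertex from [O]. *)
Ltac cross l x y z dx dy dz :=
  first
    [ assert (l mod 4 = 1) by lia; destruct (Z_lt_dec 4 l);
      [ move_to x y z (x - dx) (y - dy) (z - dz) | ]
    | assert (l mod 4 = 3) by lia; destruct (Z_lt_dec l 0);
      [ move_to x y z (x + dx) (y + dy) (z + dz) | ]
    | idtac ].

(** An alcove none of whose walls separates it from the base alcove is the base alcove. Two
    coordinates are 0 and 2 modulo 4 and the third is odd, so exactly four forms are odd; reflecting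
    in their nearest planes gives the four neighbours. If none of these moves descends, the bounds
    left on the four forms leave only [O]. *)
Lemma separation_descent p :
  inV p -> p = O \/ exists q, adj q p /\ separation q < separation p.
Proof.
  destruct p as [[x y] z]; intros H; apply inV_residues in H.
  destruct H as [[[[]|[]] []] | [[[[]|[]] []] | [[[]|[]] []]]];
  cross (x + y) x y z 1 1 0; cross (y - x) x y z (-1) 1 0;
  cross (y + z) x y z 0 1 1; cross (z - y) x y z 0 (-1) 1;
  cross (z + x) x y z 1 0 1; cross (z - x) x y z (-1) 0 1;
  first [ exfalso; lia | left; unfold O; repeat f_equal; lia ].
Qed.

Ltac Zify.zify_post_hook ::= idtac.

(** * Graph distance equals separation *)

Lemma walk_separation m p :
  walk m p -> inV p /\ separation p <= Z.of_nat m.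
Proof.
  induction 1 as [V | m p q W [V L] A].
  - split; [assumption | cbv; discriminate].
  - split; [apply A |]. apply separation_adj in A; lia.
Qed.

Lemma separation_walk n : forall p,
  inV p -> separation p = Z.of_nat n -> walk n p.
Proof.
  induction n as [| n IH]; intros p V E;
    destruct (separation_descent p V) as [-> | (q & A & L)].
  - now constructor.
  - pose proof (separation_nonneg q); lia.
  - now change (separation O) with 0 in E.
  - apply walkS with q; [| exact A].
    (* Descent lowers the separation and an edge lowers it by at most 1, so [q] is at exactly
       [n]. *)
    pose proof (separation_adj q p A).
    apply IH; [apply A | lia].
Qed.

Lemma dis_eq_separation p n :
  inV p -> (dis_eq p n <-> separation p = Z.of_nat n).
Proof.
  intros V; unfold dis_eq; split.
  - intros [W M]; apply walk_separation in W as [_ L].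
    pose proof (separation_nonneg p).
    destruct (Z.eq_dec (separation p) (Z.of_nat n)) as [| N]; [assumption |].
    exfalso; apply (M (Z.to_nat (separation p))); [lia |].
    apply separation_walk; [assumption | lia].
  - intros E; split; [now apply separation_walk |].
    intros m Lt W; apply walk_separation in W as [_ L]; lia.
Qed.

(** * Cardinalities of level sets *)

Lemma has_card_ext A B k :
  (forall p, A p <-> B p) -> has_card A k -> has_card B k.
Proof.
  intros E (l & N & I & L); exists l; repeat split; auto; intros H.
  - now apply E, I.
  - now apply I, E.
Qed.

Lemma has_card_empty A : (forall p, ~ A p) -> has_card A 0.
Proof.
  intros E; exists []; repeat split; [constructor | easy |].
  intros H; destruct (E _ H).
Qed.

Lemma has_card_union A B j k :
  (forall p, A p -> B p -> False) -> has_card A j -> has_card B k ->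
  has_card (fun p => A p \/ B p) (j + k).
Proof.
  intros D (l & N & I & L) (l' & N' & I' & L'); exists (l ++ l').
  split; [| split].
  - apply NoDup_app; auto. intros p H H'; apply (D p); [now apply I | now apply I'].
  - intros p; now rewrite in_app_iff, I, I'.
  - now rewrite length_app, L, L'.
Qed.

Lemma has_card_image A B k (w w' : point -> point) :
  (forall p, w' (w p) = p) -> (forall p, w (w' p) = p) ->
  (forall p, A p -> B (w p)) -> (forall p, B p -> A (w' p)) ->
  has_card A k -> has_card B k.
Proof.
  intros K K' F G (l & N & I & L); exists (map w l); split; [| split].
  - apply Injective_map_NoDup; [| exact N].
    intros p q E; rewrite <- (K p), <- (K q); now f_equal.
  - intros p; rewrite in_map_iff; split.
    + intros (q & <- & H); now apply F, I.
    + intros H; exists (w' p); split; [apply K' | now apply I, G].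
  - now rewrite length_map.
Qed.

Definition level (R : point -> Prop) (n : nat) (p : point) : Prop :=
  inV p /\ R p /\ separation p = Z.of_nat n.

(** On generating functions this is multiplication by t^k. *)
Definition delay (k : nat) (T : nat -> nat) (n : nat) : nat :=
  if (k <=? n)%nat then T (n - k)%nat else 0%nat.

(** Equivalence on vertices is enough: the later decompositions are into open pieces, and no vertex
    lies on the dividing planes. *)
Lemma level_ext R R' n k :
  (forall p, inV p -> (R p <-> R' p)) ->
  has_card (level R n) k -> has_card (level R' n) k.
Proof.
  intros E; apply has_card_ext; intros p; unfold level.
  split; intros (V & H & S); (split; [exact V | split; [now apply E | exact S]]).
Qed.

Lemma level_union R R' n j k :
  (forall p, R p -> R' p -> False) ->
  has_card (level R n) j -> has_card (level R' n) k ->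
  has_card (level (fun p => R p \/ R' p) n) (j + k).
Proof.
  intros D H H'.
  apply has_card_ext with (fun p => level R n p \/ level R' n p).
  { intros p; unfold level; tauto. }
  apply has_card_union; [| exact H | exact H'].
  intros p (_ & P & _) (_ & P' & _); exact (D p P P').
Qed.

(** The count of [R] is required only at the level [n - k], so that the lemma can be applied inside
    a strong induction on [n] with [R'] a part of [R]. *)
Lemma level_image (w w' : point -> point) k R R' T n :
  (forall p, w' (w p) = p) -> (forall p, w (w' p) = p) ->
  (forall p, inV p -> R p ->
     inV (w p) /\ R' (w p) /\ separation (w p) = separation p + Z.of_nat k) ->
  (forall p, inV p -> R' p -> inV (w' p) /\ R (w' p)) ->
  (forall m, (m + k = n)%nat -> has_card (level R m) (T m)) ->
  has_card (level R' n) (delay k T n).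
Proof.
  intros K K' F G H; unfold delay.
  assert (forall p, inV p -> R' p ->
    separation p = separation (w' p) + Z.of_nat k) as E.
  { intros p V P; destruct (G p V P) as [V' P'].
    destruct (F _ V' P') as (_ & _ & E); now rewrite K' in E. }
  destruct (Nat.leb_spec k n) as [L | L].
  - apply (has_card_image (level R (n - k)) _ _ w w' K K').
    + intros p (V & P & S); destruct (F p V P) as (V' & P' & S').
      repeat split; [assumption | assumption | lia].
    + intros p (V & P & S); destruct (G p V P) as (V' & P').
      specialize (E p V P); repeat split; [assumption | assumption | lia].
    + apply H; lia.
  - apply has_card_empty; intros p (V & P & S); specialize (E p V P).
    pose proof (separation_nonneg (w' p)); lia.
Qed.

(* [R] is the disjoint union of the iterated images of [R0] under [w]. *)
Lemma level_iterate (w w' : point -> point) k R R0 R1 B T :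
  (0 < k)%nat ->
  (forall p, w' (w p) = p) -> (forall p, w (w' p) = p) ->
  (forall p, inV p -> R p ->
     inV (w p) /\ R1 (w p) /\ separation (w p) = separation p + Z.of_nat k) ->
  (forall p, inV p -> R1 p -> inV (w' p) /\ R (w' p)) ->
  (forall p, inV p -> (R0 p \/ R1 p <-> R p)) ->
  (forall p, R0 p -> R1 p -> False) ->
  (forall n, has_card (level R0 n) (B n)) ->
  (forall n, T n = B n + delay k T n)%nat ->
  forall n, has_card (level R n) (T n).
Proof.
  intros k0 K K' F G D N H E n; induction n as [n IH] using lt_wf_ind.
  rewrite E; apply (level_ext _ _ _ _ D).
  apply level_union; [exact N | apply H |].
  apply (level_image w w' k R R1 T n K K' F G).
  intros m M; apply IH; lia.
Qed.

Ltac solve_mod4 :=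
  match goal with
  | H : ?l mod 4 <> 0 |- ?l' mod 4 <> 0 =>
      first [ apply (mod4_shift l l' 0 H); ring
            | apply (mod4_opp l l' H); ring
            | apply (mod4_shift l l' 1 H); ring
            | apply (mod4_shift l l' (-1) H); ring
            | apply (mod4_shift l l' 2 H); ring
            | apply (mod4_shift l l' (-2) H); ring ]
  end.

Ltac linear :=
  repeat match goal with H : _ mod 4 <> 0 |- _ => clear H end; lia.

Ltac solve_separation :=
  repeat match goal with
  | |- context [fold_floor ?a] =>
      match goal with
      | |- context [fold_floor ?b] =>
          assert_fails (constr_eq a b);
          first
            [ replace a with b by ring
            | let E := fresh in assert (E : a = - b) by ring;
              rewrite (fold_floor_opp b a); [| linear | solve_mod4 | exact E]; clear E
            | let E := fresh in assert (E : a = b + 4) by ring;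
              rewrite (fold_floor_shift b a); [| linear | exact E]; clear E
            | let E := fresh in assert (E : a = b + 8) by ring;
              rewrite (fold_floor_shift2 b a); [| linear | exact E]; clear E ]
      end
  end; linear.

(** * Folding by the 24 symmetries *)

Definition on_coordinate_plane (p : point) : Prop :=
  let '(x, y, z) := p in x * y * z = 0.

Definition chamber (p : point) : Prop :=
  let '(x, y, z) := p in - y < x < y /\ y < z.

Definition square_cone (p : point) : Prop :=
  let '(x, y, z) := p in - z < x < z /\ - z < y < z.

(** These maps generate all signed permutations. The whole space and the coordinate planes both
    qualify, so one folding argument serves both counts. *)
Definition coordinate_symmetric (Q : point -> Prop) : Prop :=
  forall x y z, Q (x, y, z) ->
    Q (y, x, z) /\ Q (x, z, y) /\ Q (- x, y, z).

(** Multiplication by (1+t)^2, and in [fold6] by (1+t^2)(1+t+t^2). The product is the Poincaré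
    polynomial of the Weyl group A3. *)
Definition fold4 (T : nat -> nat) (n : nat) : nat :=
  T n + (delay 1 T n + (delay 1 T n + delay 2 T n)).

Definition fold6 (T : nat -> nat) (n : nat) : nat :=
  T n + (delay 1 T n + (delay 2 T n + (delay 2 T n + (delay 3 T n + delay 4 T n)))).

Ltac transport :=
  repeat match goal with p : point |- _ => destruct p as [[? ?] ?] end;
  cbn beta iota delta [chamber square_cone inV separation] in *;
  repeat match goal with H : _ /\ _ |- _ => destruct H end;
  repeat split;
  match goal with
  | |- (_, _, _) = _ => repeat f_equal; ring
  | |- _ mod 4 <> 0 => solve_mod4
  | |- _ + _ = _ => solve_separation
  | |- _ < _ => linear
  | |- _ => eauto 9
  end.

(** The planes x + y = 0 and x = y cut the cone into four chambers. The symmetries used permute the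
    four forms containing z, and each delay is the number of forms among x + y and y - x that change
    sign. *)
Lemma level_fold4 Q T :
  coordinate_symmetric Q ->
  (forall n, has_card (level (fun p => Q p /\ chamber p) n) (T n)) ->
  forall n, has_card (level (fun p => Q p /\ square_cone p) n) (fold4 T n).
Proof.
  intros C H n.
  assert (forall x y z, Q (x, y, z) -> Q (y, x, z)) as C1 by apply C.
  assert (forall x y z, Q (x, y, z) -> Q (x, z, y)) as C2 by apply C.
  assert (forall x y z, Q (x, y, z) -> Q (- x, y, z)) as C3 by apply C.
  clear C.
  apply (level_ext (fun p => (Q p /\ chamber p) \/
    ((Q p /\ let '(x, y, z) := p in - x < y < x /\ x < z) \/
    ((Q p /\ let '(x, y, z) := p in x < y < - x /\ - x < z) \/
     (Q p /\ let '(x, y, z) := p in y < x < - y /\ - y < z))))).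
  { intros [[x y] z] V; cbn.
    assert (forall l, l mod 4 <> 0 -> l <> 0) as N by (intros l M ->; now apply M).
    destruct V as (V1 & V2 & _); apply N in V1, V2; clear N H C1 C2 C3; split.
    - intros [[q A] | [[q A] | [[q A] | [q A]]]]; (split; [exact q | lia]).
    - intros [q A].
      assert (- y < x < y /\ y < z \/ - x < y < x /\ x < z \/
        x < y < - x /\ - x < z \/ y < x < - y /\ - y < z) by (clear q; lia).
      tauto. }
  apply level_union; [intros [[x y] z]; cbn; lia | apply H |].
  apply level_union; [intros [[x y] z]; cbn; lia | |].
  2: apply level_union; [intros [[x y] z]; cbn; lia | |].
  - apply (level_image (fun '(x, y, z) => (y, x, z)) (fun '(x, y, z) => (y, x, z))
      1 (fun p => Q p /\ chamber p)); intros; [transport.. | apply H].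
  - apply (level_image (fun '(x, y, z) => (- y, - x, z))
      (fun '(x, y, z) => (- y, - x, z))
      1 (fun p => Q p /\ chamber p)); intros; [transport.. | apply H].
  - apply (level_image (fun '(x, y, z) => (- x, - y, z))
      (fun '(x, y, z) => (- x, - y, z))
      2 (fun p => Q p /\ chamber p)); intros; [transport.. | apply H].
Qed.

(** Six cones surround the half-axes. On [square_cone] the forms x + y and y - x have no fixed sign,
    so each symmetry is chosen to carry them to forms with sign +; the delay is then the number of
    the other four, all positive, that are negated. *)
Lemma level_fold6 Q T :
  coordinate_symmetric Q ->
  (forall n, has_card (level (fun p => Q p /\ square_cone p) n) (T n)) ->
  forall n, has_card (level Q n) (fold6 T n).
Proof.
  intros C H n.
  assert (forall x y z, Q (x, y, z) -> Q (y, x, z)) as C1 by apply C.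
  assert (forall x y z, Q (x, y, z) -> Q (x, z, y)) as C2 by apply C.
  assert (forall x y z, Q (x, y, z) -> Q (- x, y, z)) as C3 by apply C.
  clear C.
  apply (level_ext (fun p => (Q p /\ square_cone p) \/
    ((Q p /\ let '(x, y, z) := p in - y < x < y /\ - y < z < y) \/
    ((Q p /\ let '(x, y, z) := p in - x < y < x /\ - x < z < x) \/
    ((Q p /\ let '(x, y, z) := p in x < y < - x /\ x < z < - x) \/
    ((Q p /\ let '(x, y, z) := p in y < x < - y /\ y < z < - y) \/
     (Q p /\ let '(x, y, z) := p in z < x < - z /\ z < y < - z))))))).
  { intros [[x y] z] V; cbn.
    assert (forall l, l mod 4 <> 0 -> l <> 0) as N by (intros l M ->; now apply M).
    destruct V as (V1 & V2 & V3 & V4 & V5 & V6); apply N in V1, V2, V3, V4, V5, V6.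
    clear N H C1 C2 C3; split; [tauto |].
    intros q.
    assert (- z < x < z /\ - z < y < z \/ - y < x < y /\ - y < z < y \/
      - x < y < x /\ - x < z < x \/ x < y < - x /\ x < z < - x \/
      y < x < - y /\ y < z < - y \/ z < x < - z /\ z < y < - z)
      by (clear q; lia).
    tauto. }
  apply level_union; [intros [[x y] z]; cbn; lia | apply H |].
  apply level_union; [intros [[x y] z]; cbn; lia | |].
  2: apply level_union; [intros [[x y] z]; cbn; lia | |].
  3: apply level_union; [intros [[x y] z]; cbn; lia | |].
  4: apply level_union; [intros [[x y] z]; cbn; lia | |].
  - apply (level_image (fun '(x, y, z) => (x, z, y)) (fun '(x, y, z) => (x, z, y))
      1 (fun p => Q p /\ square_cone p)); intros; [transport.. | apply H].
  - apply (level_image (fun '(x, y, z) => (z, x, y)) (fun '(x, y, z) => (y, z, x))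
      2 (fun p => Q p /\ square_cone p)); intros; [transport.. | apply H].
  - apply (level_image (fun '(x, y, z) => (- z, - x, y))
      (fun '(x, y, z) => (- y, z, - x))
      2 (fun p => Q p /\ square_cone p)); intros; [transport.. | apply H].
  - apply (level_image (fun '(x, y, z) => (- x, - z, y))
      (fun '(x, y, z) => (- x, z, - y))
      3 (fun p => Q p /\ square_cone p)); intros; [transport.. | apply H].
  - apply (level_image (fun '(x, y, z) => (- x, y, - z))
      (fun '(x, y, z) => (- x, y, - z))
      4 (fun p => Q p /\ square_cone p)); intros; [transport.. | apply H].
Qed.

(** * The vertices of one box *)

Lemma level_list R (pts : list point) n :
  NoDup pts -> (forall p, In p pts -> inV p /\ R p) ->
  (forall p, inV p -> R p -> In p pts) ->
  has_card (level R n)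
    (length (filter (fun p => separation p =? Z.of_nat n) pts)).
Proof.
  intros N I J; eexists; split; [apply NoDup_filter, N | split; [| reflexivity]].
  intros p; rewrite filter_In, Z.eqb_eq; unfold level.
  split; [intros [H E]; now destruct (I p H) | intros (V & P & E); auto].
Qed.

(** The three forms are simple roots of A3. Each of the translations (2,2,2), (-2,2,2), (0,0,4) adds
    4 to one of them and fixes the other two. *)
Definition box (p : point) : Prop :=
  let '(x, y, z) := p in 0 < x + y < 4 /\ 0 < y - x < 4 /\ 0 < z - y < 4.

Definition box_count (n : nat) : nat := nth n [1; 1; 2; 1; 1]%nat 0%nat.

Lemma inV_box x y z : inV (x, y, z) -> box (x, y, z) ->
  In (x, y, z)
    [(0, 1, 2); (0, 2, 3); (1, 2, 4); (-1, 2, 4); (0, 2, 5); (0, 3, 6)].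
Proof.
  intros V (X & Y & Z0).
  assert (x = -1 \/ x = 0 \/ x = 1) as Dx by lia.
  assert (y = 1 \/ y = 2 \/ y = 3) as Dy by lia.
  assert (z = y + 1 \/ z = y + 2 \/ z = y + 3) as Dz by lia.
  revert V X Y; clear Z0.
  destruct Dx as [-> | [-> | ->]], Dy as [-> | [-> | ->]], Dz as [-> | [-> | ->]];
    cbv; intuition congruence.
Qed.

Lemma level_box n : has_card (level box n) (box_count n).
Proof.
  evar (k : nat); replace (box_count n) with k; subst k.
  - apply level_list with
      (pts := [(0, 1, 2); (0, 2, 3); (1, 2, 4); (-1, 2, 4); (0, 2, 5); (0, 3, 6)]).
    + repeat constructor; cbn; intuition congruence.
    + intros p H; repeat destruct H as [<- | H]; try easy; cbv; intuition congruence.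
    + intros [[x y] z]; apply inV_box.
  - do 5 (destruct n as [| n]; [reflexivity |]).
    (* From level 5 on the filter is empty, as no listed vertex has separation above 4. *)
    unfold box_count; cbn [filter].
    repeat match goal with |- context [separation ?p =? ?m] =>
      destruct (Z.eqb_spec (separation p) m) as [E | _];
      [exfalso; cbv [separation fold_floor] in E; cbn in E; lia |]
    end.
    now destruct n.
Qed.

Definition planar_box (p : point) : Prop :=
  let '(x, y, z) := p in x = 0 /\ 0 < y < 4 /\ 0 < z - y < 4.

Definition planar_box_count (n : nat) : nat := nth n [1; 1; 0; 1; 1]%nat 0%nat.

Lemma level_planar_box n : has_card (level planar_box n) (planar_box_count n).
Proof.
  evar (k : nat); replace (planar_box_count n) with k; subst k.
  - apply level_list with (pts := [(0, 1, 2); (0, 2, 3); (0, 2, 5); (0, 3, 6)]).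
    + repeat constructor; cbn; intuition congruence.
    + intros p H; repeat destruct H as [<- | H]; try easy; cbv; intuition congruence.
    + intros [[x y] z] V P; cbn in P.
      pose proof (inV_box x y z V ltac:(cbn; lia)) as I.
      cbn in I |- *.
      repeat destruct I as [I | I]; auto; injection I as <- <- <-; now destruct P.
  - do 5 (destruct n as [| n]; [reflexivity |]).
    unfold planar_box_count; cbn [filter].
    repeat match goal with |- context [separation ?p =? ?m] =>
      destruct (Z.eqb_spec (separation p) m) as [E | _];
      [exfalso; cbv [separation fold_floor] in E; cbn in E; lia |]
    end.
    now destruct n.
Qed.

(** * Tiling the chamber by translates *)

Definition prism (p : point) : Prop :=
  let '(x, y, z) := p in 0 < x + y < 4 /\ 0 < y - x < 4 /\ y < z.

Definition slab (p : point) : Prop :=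
  let '(x, y, z) := p in 0 < x + y < 4 /\ 0 < y - x /\ y < z.

Definition planar_prism (p : point) : Prop :=
  let '(x, y, z) := p in x = 0 /\ 0 < y < 4 /\ y < z.

Definition planar_chamber (p : point) : Prop :=
  let '(x, y, z) := p in x = 0 /\ 0 < y < z.

Lemma mod4_neq_4 l : l mod 4 <> 0 -> l <> 4.
Proof. now intros H ->. Qed.

Ltac transport_iterate :=
  cbn beta iota delta [box prism slab planar_box planar_prism planar_chamber] in *; transport.

Definition prism_count (n : nat) : nat :=
  match n with 0 => 1 | S _ => if Nat.even n then 2 else 1 end%nat.

Definition slab_count (n : nat) : nat := S (Nat.div2 n).

(** The number of partitions of [n] into parts at most 3, as [slab_count] is that for parts at most
    2: the generating function is 1/((1-t)(1-t^2)(1-t^3)), with the exponents 1, 2, 3 of A3. *)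
Fixpoint chamber_count (n : nat) : nat :=
  match n with
  | S (S (S m)) => slab_count n + chamber_count m
  | _ => slab_count n
  end%nat.

Fixpoint planar_prism_count (n : nat) : nat :=
  match n with
  | 0 => 1 | 1 => 1 | 2 => 0 | 3 => 1 | 4 => 2
  | S (S (S (S m))) => planar_prism_count m
  end%nat.

Fixpoint planar_chamber_count (n : nat) : nat :=
  match n with
  | S (S (S (S (S (S m))))) => planar_prism_count n + planar_chamber_count m
  | _ => planar_prism_count n
  end%nat.

Lemma prism_count_rec n :
  prism_count n = (box_count n + delay 4 prism_count n)%nat.
Proof.
  do 5 (destruct n as [| n]; [reflexivity |]).
  now destruct n.
Qed.

Lemma slab_count_rec n :
  slab_count n = (prism_count n + delay 3 slab_count n)%nat.
Proof.
  do 3 (destruct n as [| n]; [reflexivity |]).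
  change (S (S (Nat.div2 (S n))) =
    (if Nat.even (S n) then 2 else 1) + S (Nat.div2 (n - 0)))%nat.
  rewrite Nat.sub_0_r.
  (* [Nat.div2] grows from [n] to [S n] exactly for odd [n], which is when the prism contributes 2
     instead of 1. *)
  destruct (Nat.Even_or_Odd n) as [[m ->] | [m ->]].
  - rewrite Nat.even_succ, Nat.odd_mul, Nat.div2_succ_double, Nat.div2_double; cbn; lia.
  - rewrite Nat.even_succ, Nat.odd_add, Nat.odd_mul, Nat.add_1_r.
    change (S (S (2 * m)))%nat with (2 + 2 * m)%nat.
    rewrite Nat.div2_succ_double.
    change (Nat.div2 (2 + 2 * m)) with (S (Nat.div2 (2 * m))).
    rewrite Nat.div2_double; cbn; lia.
Qed.

Lemma chamber_count_rec n :
  chamber_count n = (slab_count n + delay 3 chamber_count n)%nat.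
Proof.
  do 3 (destruct n as [| n]; [reflexivity |]).
  unfold delay; cbn [Nat.leb Nat.sub]; now rewrite Nat.sub_0_r.
Qed.

Lemma planar_prism_count_rec n :
  planar_prism_count n = (planar_box_count n + delay 4 planar_prism_count n)%nat.
Proof.
  do 5 (destruct n as [| n]; [reflexivity |]).
  now destruct n.
Qed.

Lemma planar_chamber_count_rec n :
  planar_chamber_count n =
  (planar_prism_count n + delay 6 planar_chamber_count n)%nat.
Proof.
  do 6 (destruct n as [| n]; [reflexivity |]).
  unfold delay; cbn [Nat.leb Nat.sub]; now rewrite Nat.sub_0_r.
Qed.

(** The translation adds 4 to each of the four forms containing z, all positive here, hence the
    delay 4. *)
Lemma level_prism n : has_card (level prism n) (prism_count n).
Proof.
  revert n; apply (level_iterate (fun '(x, y, z) => (x, y, z + 4))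
    (fun '(x, y, z) => (x, y, z - 4)) 4 prism box
    (fun '(x, y, z) => 0 < x + y < 4 /\ 0 < y - x < 4 /\ 4 < z - y)
    box_count prism_count);
    [lia | intros [[x y] z].. | apply level_box | apply prism_count_rec].
  - repeat f_equal; ring.
  - repeat f_equal; ring.
  - intros; transport_iterate.
  - intros; transport_iterate.
  - intros (_ & _ & _ & V & _); apply mod4_opp with (l' := z - y) in V; [| ring].
    apply mod4_neq_4 in V; cbn; lia.
  - cbn; lia.
Qed.

Lemma level_slab n : has_card (level slab n) (slab_count n).
Proof.
  revert n; apply (level_iterate (fun '(x, y, z) => (x - 2, y + 2, z + 2))
    (fun '(x, y, z) => (x + 2, y - 2, z - 2)) 3 slab prism
    (fun '(x, y, z) => 0 < x + y < 4 /\ 4 < y - x /\ y < z)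
    prism_count slab_count);
    [lia | intros [[x y] z].. | apply level_prism | apply slab_count_rec].
  - repeat f_equal; ring.
  - repeat f_equal; ring.
  - intros; transport_iterate.
  - intros; transport_iterate.
  - intros (_ & V & _); apply mod4_opp with (l' := y - x) in V; [| ring].
    apply mod4_neq_4 in V; cbn; lia.
  - cbn; lia.
Qed.

(** The three sums x + y, y + z, z + x each gain 4 and the differences are unchanged, hence the
    delay 3. *)
Lemma level_chamber n : has_card (level chamber n) (chamber_count n).
Proof.
  revert n; apply (level_iterate (fun '(x, y, z) => (x + 2, y + 2, z + 2))
    (fun '(x, y, z) => (x - 2, y - 2, z - 2)) 3 chamber slab
    (fun '(x, y, z) => 4 < x + y /\ 0 < y - x /\ y < z)
    slab_count chamber_count);
    [lia | intros [[x y] z].. | apply level_slab | apply chamber_count_rec].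
  - repeat f_equal; ring.
  - repeat f_equal; ring.
  - intros; transport_iterate.
  - intros; transport_iterate.
  - intros [V _]; apply mod4_neq_4 in V; cbn; lia.
  - cbn; lia.
Qed.

Lemma level_planar_prism n : has_card (level planar_prism n) (planar_prism_count n).
Proof.
  revert n; apply (level_iterate (fun '(x, y, z) => (x, y, z + 4))
    (fun '(x, y, z) => (x, y, z - 4)) 4 planar_prism planar_box
    (fun '(x, y, z) => x = 0 /\ 0 < y < 4 /\ 4 < z - y)
    planar_box_count planar_prism_count);
    [lia | intros [[x y] z].. | apply level_planar_box | apply planar_prism_count_rec].
  - repeat f_equal; ring.
  - repeat f_equal; ring.
  - intros; transport_iterate.
  - intros; transport_iterate.
  - intros (_ & _ & _ & V & _); apply mod4_opp with (l' := z - y) in V; [| ring].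
    apply mod4_neq_4 in V; cbn; lia.
  - cbn; lia.
Qed.

(** Here y + z gains 8, z - y is unchanged and the other four forms gain 4, hence the delay 6. *)
Lemma level_planar_chamber n : has_card (level planar_chamber n) (planar_chamber_count n).
Proof.
  revert n; apply (level_iterate (fun '(x, y, z) => (x, y + 4, z + 4))
    (fun '(x, y, z) => (x, y - 4, z - 4)) 6 planar_chamber planar_prism
    (fun '(x, y, z) => x = 0 /\ 4 < y < z)
    planar_prism_count planar_chamber_count);
    [lia | intros [[x y] z].. | apply level_planar_prism | apply planar_chamber_count_rec].
  - repeat f_equal; ring.
  - repeat f_equal; ring.
  - intros; transport_iterate.
  - intros; transport_iterate.
  - intros [V _]; apply mod4_neq_4 in V; cbn; lia.
  - cbn; lia.
Qed.

(** * Closed forms of the counts *)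

Lemma chamber_count_step n :
  chamber_count (S (S (S n))) = (S (S (Nat.div2 (S n))) + chamber_count n)%nat.
Proof. reflexivity. Qed.

Lemma fold_chamber_count n :
  fold6 (fold4 chamber_count) n = match n with 0 => 1 | S _ => 2 * (n * n + 1) end%nat.
Proof.
  (* The combined delays reach 6, so from 6 on none of them truncates. *)
  do 6 (destruct n as [| n]; [reflexivity |]).
  unfold fold6, fold4, delay; cbn [Nat.leb Nat.sub].
  rewrite ?Nat.sub_0_r.
  induction n as [| n IH]; [reflexivity |].
  (* Steps of 3 reduce everything to the values at [n], [n + 1], [n + 2]. As 1+t+t^2 divides the
     folding polynomial, each occurs 8 times in both the hypothesis and the goal and cancels,
     leaving only halves. *)
  rewrite (chamber_count_step (S (S (S (S n))))), (chamber_count_step (S (S (S n)))),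
    (chamber_count_step (S (S n))), (chamber_count_step (S n)), (chamber_count_step n) in *.
  assert (Nat.div2 n + Nat.div2 (S n) = n)%nat
    by (clear IH; induction n; cbn [Nat.div2] in *; lia).
  cbn [Nat.div2] in *; lia.
Qed.

Lemma planar_prism_count_step n :
  planar_prism_count (S (S (S (S (S n))))) = planar_prism_count (S n).
Proof. reflexivity. Qed.

(** The sum over one period of length 4. It starts at [S n] because the value at 0 is outside the
    periodic range. *)
Lemma planar_prism_count_sum n :
  (planar_prism_count (S n) + planar_prism_count (S (S n)) +
   planar_prism_count (S (S (S n))) + planar_prism_count (S (S (S (S n)))) = 4)%nat.
Proof.
  induction n as [| n IH]; [reflexivity |].
  rewrite planar_prism_count_step; lia.
Qed.

Lemma planar_chamber_count_step n :
  planar_chamber_count (S (S (S (S (S (S n)))))) =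
  (planar_prism_count (S (S (S (S (S (S n)))))) + planar_chamber_count n)%nat.
Proof. reflexivity. Qed.

Lemma fold_planar_chamber_count n :
  fold6 (fold4 planar_chamber_count) n = match n with 0 => 1 | S _ => 4 * n end%nat.
Proof.
  do 6 (destruct n as [| n]; [reflexivity |]).
  unfold fold6, fold4, delay; cbn [Nat.leb Nat.sub].
  rewrite ?Nat.sub_0_r.
  induction n as [n IH] using lt_wf_ind.
  do 6 (destruct n as [| n]; [reflexivity |]).
  specialize (IH n ltac:(lia)).
  (* The increment over six levels is the folding polynomial applied to [planar_prism_count]. Its
     coefficients add up to 6 in each class modulo 4, so the increment is 6 times a period sum, that
     is 24. *)
  rewrite (planar_chamber_count_step (S (S (S (S (S (S n))))))),
    (planar_chamber_count_step (S (S (S (S (S n)))))),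
    (planar_chamber_count_step (S (S (S (S n))))),
    (planar_chamber_count_step (S (S (S n)))),
    (planar_chamber_count_step (S (S n))), (planar_chamber_count_step (S n)),
    (planar_chamber_count_step n) in *.
  pose proof (planar_prism_count_sum n).
  rewrite !planar_prism_count_step in *; lia.
Qed.

(** * The two coordination sequences *)

Lemma has_card_Sset n : has_card (Sset n) (fold6 (fold4 chamber_count) n).
Proof.
  apply has_card_ext with (level (fun _ => True) n).
  { intros p; unfold Sset, level.
    split; [intros (V & _ & D) | intros [V D]]; apply dis_eq_separation in D; auto. }
  apply level_fold6; [now intros x y z _ | intros m].
  apply level_fold4; [now intros x y z _ | clear m; intros m].
  apply level_ext with chamber; [tauto | apply level_chamber].
Qed.

Lemma has_card_Sbarset n :
  has_card (Sbarset n) (fold6 (fold4 planar_chamber_count) n).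
Proof.
  assert (coordinate_symmetric on_coordinate_plane)
    by (intros x y z; cbn; repeat split; lia).
  apply has_card_ext with (level on_coordinate_plane n).
  { intros p; unfold Sbarset, level.
    split; [intros (V & P & D) | intros (V & D & P)]; apply dis_eq_separation in D; auto. }
  apply level_fold6; [assumption | intros m].
  apply level_fold4; [assumption | clear m; intros m].
  apply level_ext with planar_chamber; [| apply level_planar_chamber].
  (* In the chamber y and z are positive, so only x can vanish. *)
  intros [[x y] z] _; cbn; split.
  - intros (-> & A); split; [ring | lia].
  - intros (P & A); split; [| lia].
    apply Z.mul_eq_0 in P as [P | P]; [apply Z.mul_eq_0 in P as [P | P] |]; lia.
Qed.

Theorem theorem2 :
  has_card (Sbarset 0) 1 /\
  (forall n : nat, (0 < n)%nat -> has_card (Sbarset n) (4 * n)) /\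
  has_card (Sset 0) 1 /\
  (forall n : nat, (0 < n)%nat -> has_card (Sset n) (2 * (n * n + 1))).
Proof.
  pose proof (fun n => eq_ind _ _ (has_card_Sbarset n) _ (fold_planar_chamber_count n)) as P.
  pose proof (fun n => eq_ind _ _ (has_card_Sset n) _ (fold_chamber_count n)) as H.
  split; [exact (P 0%nat) | split; [| split; [exact (H 0%nat) |]]];
    (intros [| n] L; [lia |]); [apply P | apply H].
Qed.
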